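(* For every integer $m\ge 3$, $$\mathrm{dom}_t(K_2\Box P_m)=\begin{cases} m & \text{if } m\equiv 0 \pmod 4,\\ m+1 & \text{otherwise.}\end{cases}$$
   Context: An orientation of a (finite simple) graph $G$ is a digraph obtained by directing each edge $uv$ of $G$ in exactly one of the two directions $(u,v)$ or $(v,u)$. The orientation is valid if every vertex has in-degree at least $1$. A set $S\subseteq V(D)$ is a total dominating set of a digraph $D$ if every vertex of $D$ (including those in $S$) has an in-neighbor in $S$; $\gamma_t(D)$ is the minimum cardinality of a total dominating set of $D$. For a graph $G$ in which every component contains a cycle (equivalently, $G$ has a valid orientation), $\mathrm{dom}_t(G)$ is the minimum of $\gamma_t(D)$ over all valid orientations $D$ of $G$. $P_m$ is the path on $m$ vertices, $K_2$ is the complete graph on two vertices, and $G\Box H$ is the Cartesian product: vertex set $V(G)\times V(H)$, with $(g,h)$ adjacent to $(g',h')$ iff either $g=g'$ and $hh'\in E(H)$, or $gg'\in E(G)$ and $h=h'$. *)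

(* Defs.v *)
From mathcomp Require Import all_boot.

Set Implicit Arguments.
Unset Strict Implicit.
Unset Printing Implicit Defensive.

Record sgraph := SGraph {
  vertex :> finType;
  edge : rel vertex;
  edge_sym : symmetric edge;
  edge_irr : irreflexive edge }.
Arguments edge {G} : rename.

Definition complete_edge n : rel 'I_n := fun i j => i != j.

Lemma complete_edge_sym n : symmetric (@complete_edge n).
Proof. by move=> i j; rewrite /complete_edge eq_sym. Qed.

Lemma complete_edge_irr n : irreflexive (@complete_edge n).
Proof. by move=> i; rewrite /complete_edge eqxx. Qed.

Definition complete_graph n : sgraph :=
  SGraph (@complete_edge_sym n) (@complete_edge_irr n).

Definition path_edge n : rel 'I_n :=
  fun i j => (i.+1 == j :> nat) || (j.+1 == i :> nat).

Lemma path_edge_sym n : symmetric (@path_edge n).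
Proof. by move=> i j; rewrite /path_edge orbC. Qed.

Lemma path_edge_irr n : irreflexive (@path_edge n).
Proof. by move=> i; rewrite /path_edge orbb eqn_leq ltnn. Qed.

Definition path_graph n : sgraph :=
  SGraph (@path_edge_sym n) (@path_edge_irr n).

Section CartesianProduct.
Variables G H : sgraph.

Definition cprod_edge : rel (G * H) := fun x y =>
  (x.1 == y.1) && edge x.2 y.2 || edge x.1 y.1 && (x.2 == y.2).

Lemma cprod_edge_sym : symmetric cprod_edge.
Proof.
move=> x y; rewrite /cprod_edge (eq_sym x.1) (eq_sym x.2).
by rewrite (edge_sym x.1) (edge_sym x.2).
Qed.

Lemma cprod_edge_irr : irreflexive cprod_edge.
Proof. by move=> x; rewrite /cprod_edge !edge_irr andbF. Qed.

Definition cprod : sgraph := SGraph cprod_edge_sym cprod_edge_irr.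

End CartesianProduct.

(* A digraph on [T] is its set of arcs: [(u, v) \in D] is an arc from [u] to [v]. *)
Section Digraph.
Variable T : finType.
Implicit Types (D : {set T * T}) (S : {set T}).

Definition indegree D (v : T) : nat := #|[set u | (u, v) \in D]|.

Definition total_dominating D S : bool :=
  [forall v, exists u in S, (u, v) \in D].

(* The default [#|T|] bounds every [#|S|], so this is the minimum as soon as
   a total dominating set exists; see [gamma_tP]. *)
Definition gamma_t D : nat :=
  \big[minn/#|T|]_(S : {set T} | total_dominating D S) #|S|.

End Digraph.

Section Orientation.
Variable G : sgraph.
Implicit Types D : {set G * G}.

Definition orientation D : bool :=
  [forall u, forall v,
    if edge u v then ((u, v) \in D) (+) ((v, u) \in D) else (u, v) \notin D].

Definition valid_orientation D : bool :=
  orientation D && [forall v, 0 < indegree D v].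

(* As for [gamma_t], the default is never below an actual value, so this is
   the minimum as soon as [G] has a valid orientation; see [dom_tP]. *)
Definition dom_t : nat :=
  \big[minn/#|G|]_(D : {set G * G} | valid_orientation D) gamma_t D.

End Orientation.

Lemma bigmin_le (I : finType) (P : pred I) (F : I -> nat) N i :
  P i -> \big[minn/N]_(j | P j) F j <= F i.
Proof.
move=> Pi; have: i \in index_enum I by rewrite mem_index_enum.
elim: (index_enum I) => // j s IHs; rewrite in_cons big_cons.
case/predU1P=> [<- | /IHs le_s]; first by rewrite Pi geq_minl.
by case: (P j) => //; apply: leq_trans (geq_minr _ _) le_s.
Qed.

Lemma bigmin_attained (I : finType) (P : pred I) (F : I -> nat) N k :
    (exists i, P i) -> (forall i, P i -> F i <= N) ->
  \big[minn/N]_(i | P i) F i = k <->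
  (exists2 i, P i & F i = k) /\ (forall i, P i -> k <= F i).
Proof.
move=> [i0 Pi0] leN.
have le_min i : P i -> \big[minn/N]_(j | P j) F j <= F i.
  exact: bigmin_le.
have [i Pi Ei] : exists2 i, P i & F i = \big[minn/N]_(j | P j) F j.
  case: (arg_minnP F Pi0) => i Pi min_i; exists i => //; apply/eqP.
  rewrite eqn_leq le_min // andbT; elim/big_rec: _ => [|j x Pj IH]; first exact: leN.
  by rewrite leq_min IH min_i.
split=> [<- | [[j Pj <-] minj]]; first by split=> //; exists i.
by apply/eqP; rewrite eqn_leq le_min //= -Ei minj.
Qed.

Lemma gamma_tP (T : finType) (D : {set T * T}) k :
    (exists S, total_dominating D S) ->
  gamma_t D = k <->
  (exists2 S : {set T}, total_dominating D S & #|S| = k) /\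
  (forall S : {set T}, total_dominating D S -> k <= #|S|).
Proof. by move=> exS; apply: bigmin_attained => // S _; apply: max_card. Qed.

Lemma valid_total_dominating (G : sgraph) (D : {set G * G}) :
  valid_orientation D -> total_dominating D setT.
Proof.
case/andP=> _ /forallP inD; apply/forallP=> v; move: (inD v); rewrite card_gt0.
by case/set0Pn=> u; rewrite inE => uv; apply/existsP; exists u; rewrite inE.
Qed.

Lemma dom_tP (G : sgraph) k :
    (exists D : {set G * G}, valid_orientation D) ->
  dom_t G = k <->
  (exists2 D : {set G * G}, valid_orientation D & gamma_t D = k) /\
  (forall D : {set G * G}, valid_orientation D -> k <= gamma_t D).
Proof.
move=> exD; apply: bigmin_attained => // D /valid_total_dominating tdD.
exact: leq_trans (bigmin_le (fun S : {set G} => #|S|) _ tdD) (max_card _).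
Qed.

(* Main.v *)
Require Import Defs.
From mathcomp Require Import all_boot zify.

Set Implicit Arguments.
Unset Strict Implicit.
Unset Printing Implicit Defensive.

(** Write [ladder m] for the product of K2 and the path on [m] vertices, with
    [2 * m] vertices of degree at most 3, arranged in [m] columns.

    Lower bound.  In a valid orientation every vertex has an in-neighbour, so a
    vertex of the ladder has at most two out-neighbours.  Counting the arcs
    that leave a total dominating set [S] gives [2 * m <= 2 * #|S|]
    ([card_total_dominating]).  If [#|S| = m], the count is tight: each vertex
    has exactly one in-neighbour in [S], and each vertex of [S] has degree 3
    and in-degree 1, so that its in-neighbour lies in [S] and it dominates both
    its other neighbours.  These constraints propagate along the ladder without
    any choice up to exchanging the rows ([blank_step]): columns miss [S], lie
    in [S], lie in [S], miss [S], and so on with period 4.  As [S] contains no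
    corner, the ladder ends where a period ends, so 4 divides [m]
    ([tight_mod4]).

    Upper bound.  A valid orientation and a total dominating set amount to a
    choice of a neighbour [f x] for each vertex [x] that never picks both
    directions of an edge, i.e. [f (f x) != x]; the dominating set is then the
    range of [f] ([dom_t_le]).  Such choices can be placed side by side
    ([dominable_cat]), so it suffices to find them on ladders of 4, 3, 5 and 6
    columns, with ranges of sizes 4, 4, 6 and 7, and to add blocks of 4 columns
    at unit cost per column ([dominable_mod4]). *)

(** * Bounding the total domination number of orientations *)

(** Orienting each edge between [x] and [f x] towards [x] is consistent because
    [f] has no 2-cycle; the remaining edges follow an arbitrary linear order. *)
Lemma dom_t_le (G : sgraph) (f : G -> G) (S : {set G}) :
    (forall x, edge x (f x)) -> (forall x, f (f x) != x) ->
    (forall x, f x \in S) ->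
  dom_t G <= #|S|.
Proof.
move=> edge_f ffN f_S.
pose arc u v :=
  edge u v && ((f v == u) || (f u != v) && (enum_rank u < enum_rank v)).
pose D : {set G * G} := [set p | arc p.1 p.2].
have f_arc x : (f x, x) \in D by rewrite inE /arc /= edge_sym edge_f eqxx.
have oD : orientation D.
  apply/forallP=> u; apply/forallP=> v; rewrite !inE /arc /= (edge_sym v).
  case: ifP => [uv|->//]; rewrite uv /=.
  have [fv|fvN] := eqVneq (f v) u; first by
    have := ffN v; rewrite fv => /negPf->.
  have [fu|fuN] := eqVneq (f u) v; first by [].
  rewrite /=; case: ltngtP => // /val_inj/enum_rank_inj eq_uv.
  by rewrite eq_uv edge_irr in uv.
have vD : valid_orientation D.
  rewrite /valid_orientation oD; apply/forallP=> x.
  by rewrite card_gt0; apply/set0Pn; exists (f x); rewrite inE.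
have tdS : total_dominating D S.
  by apply/forallP=> x; apply/existsP; exists (f x); rewrite f_S f_arc.
apply: leq_trans (bigmin_le _ _ vD) _.
exact: (bigmin_le (fun S : {set G} => #|S|) _ tdS).
Qed.

Lemma leq_dom_t (G : sgraph) k :
    k <= #|G| ->
    (forall (D : {set G * G}) S,
       valid_orientation D -> total_dominating D S -> k <= #|S|) ->
  k <= dom_t G.
Proof.
move=> kG kS; rewrite /dom_t; elim/big_rec: _ => // D x vD kx.
rewrite leq_min kx andbT /gamma_t.
elim/big_rec: _ => // S y tdS ky.
by rewrite leq_min ky andbT (kS D).
Qed.

Definition degree (G : sgraph) (x : G) := #|[set y | edge x y]|.
Definition outdegree (T : finType) (D : {set T * T}) x :=
  #|[set y | (x, y) \in D]|.

Section Orientation.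
Variables (G : sgraph) (D : {set G * G}).
Hypothesis oD : orientation D.

Lemma arc_edge x y : (x, y) \in D -> edge x y.
Proof.
by move: oD => /forallP/(_ x)/forallP/(_ y); case: ifP => // _ /negPf->.
Qed.

Lemma arc_rev x y : edge x y -> ((y, x) \in D) = ((x, y) \notin D).
Proof.
move=> xy; move: oD => /forallP/(_ x)/forallP/(_ y); rewrite xy.
by case: (_ \in D); case: (_ \in D).
Qed.

Lemma degree_split x : outdegree D x + indegree D x = degree x.
Proof.
rewrite /degree -(cardsID [set y | (x, y) \in D]); congr (_ + _);
  apply: eq_card => y; rewrite !inE.
  by rewrite andb_idl //; apply: arc_edge.
have [xy|nxy] := boolP (edge x y); first by rewrite andbT -arc_rev.
rewrite andbF; apply: contraNF nxy => yx.
by rewrite edge_sym (arc_edge yx).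
Qed.

End Orientation.

Definition dominators (T : finType) (D : {set T * T}) (S : {set T}) x :=
  [set s in S | (s, x) \in D].

Lemma sum_dominators (T : finType) (D : {set T * T}) (S : {set T}) :
  \sum_x #|dominators D S x| = \sum_(s in S) outdegree D s.
Proof.
transitivity (\sum_x \sum_(s in S) ((s, x) \in D : nat)).
  apply: eq_bigr => x _; rewrite -sum1_card big_mkcond [RHS]big_mkcond.
  by apply: eq_bigr => s _; rewrite inE; case: (s \in S); case: (_ \in D).
rewrite exchange_big; apply: eq_bigr => s _.
rewrite /outdegree -sum1_card [RHS]big_mkcond.
by apply: eq_bigr => x _; rewrite inE; case: (_ \in D).
Qed.

Section BoundedDegree.
Variables (G : sgraph) (d : nat).
Hypothesis degG : forall x : G, degree x <= d.+1.
Variables (D : {set G * G}) (S : {set G}).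
Hypotheses (vD : valid_orientation D) (tdS : total_dominating D S).

Let oD : orientation D. Proof. by case/andP: vD. Qed.

Lemma indegree_gt0 x : 0 < indegree D x.
Proof. by case/andP: vD => _ /forallP. Qed.

(** Both sides bound the number of arcs leaving [S]: each vertex receives at
    least one, and a vertex of [S] emits at most [d] since one of its [d.+1]
    edges points to it.  The equality case of each bound gives one conjunct. *)
Lemma card_total_dominating :
  #|G| <= d * #|S| ?= iff [forall x, 1 == #|dominators D S x|]
                       && [forall (s | s \in S), outdegree D s == d].
Proof.
rewrite mulnC -sum_nat_const -sum1_card.
apply: (@leqif_trans _ (\sum_x #|dominators D S x|)).
  apply: leqif_sum => x _; split=> //; rewrite card_gt0; apply/set0Pn.
  have /existsP[s sx] := forallP tdS x.
  by exists s; rewrite inE.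
rewrite sum_dominators; apply: leqif_sum => s _; split=> //.
have := degree_split oD s; have := degG s; have := indegree_gt0 s; lia.
Qed.

Hypothesis tight : #|G| = d * #|S|.

Lemma tight_dominator_uniq x s t :
  s \in S -> t \in S -> (s, x) \in D -> (t, x) \in D -> s = t.
Proof.
move: (card_total_dominating) => [_]; rewrite tight eqxx => /esym/andP[+ _].
move=> /forallP/(_ x); rewrite eq_sym => /cards1P[u Du] sS tS sx tx.
have: s \in dominators D S x by rewrite inE sS.
have: t \in dominators D S x by rewrite inE tS.
by rewrite Du !inE => /eqP-> /eqP.
Qed.

Lemma tight_degree s : s \in S -> degree s = d.+1 /\ indegree D s = 1.
Proof.
move: (card_total_dominating) => [_]; rewrite tight eqxx => /esym/andP[_ +].
move=> /forallP/(_ s)/implyP out sS; move/eqP: (out sS).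
have := degree_split oD s; have := degG s; have := indegree_gt0 s; lia.
Qed.

Lemma tight_in_uniq s u v :
  s \in S -> (u, s) \in D -> (v, s) \in D -> u = v.
Proof.
case/tight_degree=> _ /eqP/cards1P[w Dw] us vs.
have: u \in [set u | (u, s) \in D] by rewrite inE.
have: v \in [set u | (u, s) \in D] by rewrite inE.
by rewrite Dw !inE => /eqP-> /eqP.
Qed.

(** [s] must be dominated by some vertex of [S], and it has only one
    in-neighbour. *)
Lemma tight_in s u : s \in S -> (u, s) \in D -> u \in S.
Proof.
move=> sS us; have /existsP[t /andP[tS ts]] := forallP tdS s.
by rewrite (tight_in_uniq sS us ts).
Qed.

Lemma tight_out s u w :
  s \in S -> (u, s) \in D -> edge s w -> w != u -> (s, w) \in D.
Proof.
move=> sS us sw; apply: contraR; rewrite -(arc_rev oD sw) => ws.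
by rewrite (tight_in_uniq sS ws us).
Qed.

End BoundedDegree.

(** * The ladder *)

Lemma degree_cprod (G H : sgraph) (x : cprod G H) :
  degree x <= degree x.1 + degree x.2.
Proof.
rewrite /degree.
have -> : [set y | edge x y] =
    setX [set y | edge x.1 y] [set x.2] :|: setX [set x.1] [set y | edge x.2 y].
  apply/setP=> -[y1 y2]; rewrite !inE /edge /= /cprod_edge /=.
  by rewrite orbC (eq_sym y1) (eq_sym y2).
by apply: leq_trans (leq_card_setU _ _) _; rewrite !cardsX !cards1 muln1 mul1n.
Qed.

Lemma degree_complete n (i : complete_graph n) : degree i = n.-1.
Proof.
rewrite -[n in RHS]card_ord -(cardsC1 (i : 'I_n)).
by apply: eq_card => j; rewrite !inE /edge /= /complete_edge eq_sym.
Qed.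

Lemma degree_path n (i : path_graph n) :
  degree i <= (0 < (i : 'I_n)) + ((i : 'I_n).+1 < n).
Proof.
have -> : degree i =
    #|[set j : 'I_n | j.+1 == (i : 'I_n)]
      :|: [set j : 'I_n | (i : 'I_n).+1 == j]|.
  by apply: eq_card => j; rewrite !inE orbC.
apply: leq_trans (leq_card_setU _ _) _; apply: leq_add.
  have [->|[j]] := set_0Vmem [set j : 'I_n | j.+1 == (i : 'I_n)].
    by rewrite cards0.
  rewrite inE => /eqP <-; apply/card_le1_eqP=> k l; rewrite !inE.
  by move=> /eqP[+] /eqP[+]; move=> kj lj; apply: val_inj; rewrite /= kj lj.
have [->|[j]] := set_0Vmem [set j : 'I_n | (i : 'I_n).+1 == j].
  by rewrite cards0.
rewrite inE => /eqP ->; rewrite ltn_ord; apply/card_le1_eqP=> k l; rewrite !inE.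
by move=> /eqP kj /eqP lj; apply: val_inj; rewrite /= -kj -lj.
Qed.

Notation ladder m := (cprod (complete_graph 2) (path_graph m)).

Lemma degree_ladder m (r : 'I_2) (i : 'I_m) :
  @degree (ladder m) (r, i) <= (0 < i) + (i.+1 < m) + 1.
Proof.
apply: leq_trans (degree_cprod _) _ => /=.
by rewrite degree_complete addnC leq_add2r degree_path.
Qed.

Lemma degree_ladder_le3 m (x : ladder m) : degree x <= 3.
Proof. by case: x => r i; apply: leq_trans (degree_ladder r i) _; lia. Qed.

Lemma row_cases (r t : 'I_2) : t = r \/ t = rev_ord r.
Proof.
case: r t => [[|[|r]] rP] [[|[|t]] tP] //; [left|right|right|left];
  exact: val_inj.
Qed.

Lemma rev_row_neq (r : 'I_2) : rev_ord r != r.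
Proof. by case: r => [[|[|r]] rP]. Qed.

(** * Rigidity of total dominating sets of size m *)

Section Rigidity.
Variable n : nat.
Local Notation m := n.+1.
Variables (D : {set ladder m * ladder m}) (S : {set ladder m}).
Hypotheses (vD : valid_orientation D) (tdS : total_dominating D S).
Hypothesis card_S : #|S| = m.

(** Columns are named by natural numbers so that neighbouring columns are [i]
    and [i.+1]; [at_ r i] is meaningful only for [i < m]. *)
Definition at_ (r : 'I_2) (i : nat) : ladder m := (r, inord i).

Let oD : orientation D. Proof. by case/andP: vD. Qed.

Let tight : #|ladder m| = 2 * #|S|.
Proof. by rewrite card_prod !card_ord card_S. Qed.

Let uniqS := tight_dominator_uniq (@degree_ladder_le3 m) vD tdS tight.
Let inS := tight_in (@degree_ladder_le3 m) vD tdS tight.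
Let outS := tight_out (@degree_ladder_le3 m) vD tdS tight.

(** A vertex in an end column has degree 2, while vertices of [S] have
    degree 3. *)
Lemma inner_S r i : i < m -> at_ r i \in S -> 0 < i /\ i.+1 < m.
Proof.
move=> im /(tight_degree (@degree_ladder_le3 m) vD tdS tight)[deg3 _].
move: (degree_ladder r (inord i : 'I_m)); rewrite deg3 inordK //.
by case: (0 < i); case: (i.+1 < m).
Qed.

Lemma at_neq r i t j : i < m -> j < m -> i != j -> at_ r i != at_ t j.
Proof.
move=> im jm; apply: contraNneq => -[_ /(congr1 val)/=].
by rewrite !inordK // => ->.
Qed.

Lemma dominator_col r i t j x :
    i < m -> j < m -> at_ r i \in S -> at_ t j \in S ->
    (at_ r i, x) \in D -> (at_ t j, x) \in D ->
  i = j.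
Proof.
move=> im jm rS tS rx tx; have [//|ij] := eqVneq i j.
by have := at_neq r t im jm ij; rewrite (uniqS rS tS rx tx) eqxx.
Qed.

Lemma edge_rung r i : edge (at_ r i) (at_ (rev_ord r) i).
Proof.
apply/orP; right; rewrite /= eqxx andbT /edge /= /complete_edge eq_sym.
exact: rev_row_neq.
Qed.

Lemma edge_rung_rev r i : edge (at_ (rev_ord r) i) (at_ r i).
Proof. by rewrite edge_sym edge_rung. Qed.

Lemma edge_rail r i : i.+1 < m -> edge (at_ r i) (at_ r i.+1).
Proof.
move=> im; apply/orP; left; rewrite /= eqxx /=; apply/orP; left.
by rewrite !inordK // ltnW.
Qed.

Lemma dominated r i : i < m ->
  [\/ at_ (rev_ord r) i \in S /\ (at_ (rev_ord r) i, at_ r i) \in D,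
      exists2 j, j.+1 = i & at_ r j \in S /\ (at_ r j, at_ r i) \in D |
      i.+1 < m /\ at_ r i.+1 \in S /\ (at_ r i.+1, at_ r i) \in D].
Proof.
move=> im; have /existsP[[t j] /andP[sS sD]] := forallP tdS (at_ r i).
have sE : (t, j) = at_ t j by rewrite /at_ inord_val.
have := arc_edge oD sD; rewrite /edge /= /cprod_edge /=.
case/orP=> [/andP[/eqP tr]|/andP[tr /eqP ji]].
  rewrite sE tr in sS sD.
  rewrite /edge /= /path_edge inordK // => /orP[] /eqP ij.
    by constructor 2; exists j.
  by constructor 3; rewrite ij ltn_ord.
constructor 1; case: (row_cases r t) tr sS sD => -> tr.
  by rewrite /edge /= /complete_edge eqxx in tr.
by rewrite /at_ -ji.
Qed.

Definition blank i := forall r, at_ r i \notin S.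

(** One period.  Column [i] can only be dominated from column [i.+1], which
    therefore lies in [S]; its rung is directed towards, say, row [r].  The
    tail of that rung then needs its dominator in column [i.+2], while its head
    dominates the next vertex of row [r]; so the rung of column [i.+2] starts
    from row [r], as its head would be dominated twice otherwise.  The two
    columns carry a directed 4-cycle, which also dominates column [i.+3].  A
    vertex of [S] in column [i.+3] or [i.+4] would dominate some vertex of
    column [i.+3] a second time. *)
Lemma blank_step i : i < m -> blank i -> (0 < i -> blank i.-1) ->
  [/\ i.+3 < m, blank i.+3 & i.+4 < m -> blank i.+4].
Proof.
move=> im bl_i bl_pi.
have next r : i.+1 < m /\ at_ r i.+1 \in S.
  have [[+ _]|[j ji [+ _]]|[im1 [rS _]]] := dominated r im; last by split.
    by rewrite (negPf (bl_i _)).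
  have := bl_pi; rewrite -ji => /(_ isT) /= /(_ r) /negPf-> //.
have [im1 _] := next ord0.
have S1 r : at_ r i.+1 \in S by case: (next r).
have [_ im2] := inner_S im1 (S1 ord0).
have [r r01] : exists r, (at_ (rev_ord r) i.+1, at_ r i.+1) \in D.
  have e := edge_rung ord0 i.+1.
  have [a|a] := boolP ((at_ ord0 i.+1, at_ (rev_ord ord0) i.+1) \in D).
    by exists (rev_ord ord0); rewrite rev_ordK.
  by exists ord0; rewrite (arc_rev oD e).
set r' := rev_ord r in r01.
have r'r : rev_ord r' = r by rewrite rev_ordK.
have r12 : (at_ r i.+1, at_ r i.+2) \in D.
  apply: outS (S1 _) r01 (edge_rail _ _) _ => //.
  by rewrite at_neq // gtn_eqF.
have S2' : at_ r' i.+2 \in S.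
  have [[_]|[j [->] [+ _]]|[_ []//]] := dominated r' im1.
    by rewrite r'r (arc_rev oD) ?r01 // edge_rung_rev.
  by rewrite (negPf (bl_i _)).
have r22 : (at_ r i.+2, at_ r' i.+2) \in D.
  rewrite (arc_rev oD (edge_rung_rev r i.+2)); apply/negP=> r22'.
  by have /n_Sn := dominator_col im1 im2 (S1 r) S2' r12 r22'.
have S2 : at_ r i.+2 \in S := inS S2' r22.
have [_ im3] := inner_S im2 S2.
have all23 t : at_ t i.+2 \in S /\ (at_ t i.+2, at_ t i.+3) \in D.
  case: (row_cases r t) => ->; split=> //.
    by apply: outS S2 r12 (edge_rail _ _) _ => //; rewrite at_neq // gtn_eqF.
  by apply: outS S2' r22 (edge_rail _ _) _ => //; rewrite at_neq // gtn_eqF.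
have bl_3 : blank i.+3.
  move=> t; apply/negP=> S3; have [_ t23] := all23 t.
  have [S2u u23] := all23 (rev_ord t).
  have t33 : (at_ t i.+3, at_ (rev_ord t) i.+3) \in D.
    by apply: outS S3 t23 (edge_rung _ _) _; rewrite at_neq // gtn_eqF.
  by have /n_Sn := dominator_col im2 im3 S2u S3 u23 t33.
split=> // im4 t; apply/negP=> S4; have [S2t t23] := all23 t.
have t43 : (at_ t i.+4, at_ t i.+3) \in D.
  rewrite (arc_rev oD) ?edge_rail //; apply/negP=> /(inS S4).
  exact/negP/bl_3.
have /eqP := dominator_col im2 im4 S2t S4 t23 t43.
by rewrite ltn_eqF // ltnW.
Qed.

Lemma tight_mod4 : m %% 4 = 0.
Proof.
have blanks k : 4 * k < m -> blank (4 * k) /\ (0 < 4 * k -> blank (4 * k).-1).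
  elim: k => [|k IHk] km.
    split=> // r; apply/negP=> /(inner_S (ltn0Sn n))[]; lia.
  have km' : 4 * k < m by lia.
  have [bl bl'] := IHk km'; have [_ bl3 bl4] := blank_step km' bl bl'.
  have E : 4 * k.+1 = (4 * k).+4 by lia.
  by rewrite E in km *; split=> [|_ //]; apply: bl4.
have [km|] := boolP (4 * (m %/ 4) < m); last by lia.
have [bl bl'] := blanks _ km; have [] := blank_step km bl bl'; lia.
Qed.

End Rigidity.

(** * Gluing small ladders *)

(** Here the vertices are pairs (row, column) of natural numbers, so that
    ladders of different lengths share a type and checking a small one is a
    computation. *)
Definition grid_adj (x y : nat * nat) :=
  (x.1 == y.1) && ((x.2.+1 == y.2) || (y.2.+1 == x.2))
  || (x.1 != y.1) && (x.2 == y.2).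

Definition parent_ok m (s : seq (nat * nat)) f (x : nat * nat) :=
  [&& f x \in s, (f x).1 < 2, (f x).2 < m, grid_adj x (f x) & f (f x) != x].

Definition dominable m c := exists f, exists2 s : seq (nat * nat),
  size s = c & forall x, x.1 < 2 -> x.2 < m -> parent_ok m s f x.

Lemma dominable_cat m1 c1 m2 c2 :
  dominable m1 c1 -> dominable m2 c2 -> dominable (m1 + m2) (c1 + c2).
Proof.
move=> [f1 [s1 <- ok1]] [f2 [s2 <- ok2]].
pose up (x : nat * nat) := (x.1, m1 + x.2).
pose down (x : nat * nat) := (x.1, x.2 - m1).
have upK : cancel up down by case=> a b; rewrite /down /= addKn.
have up_ge x : (up x).2 < m1 = false by rewrite /=; lia.
pose f x := if x.2 < m1 then f1 x else up (f2 (down x)).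
exists f, (s1 ++ map up s2) => [|x x1 x2]; first by rewrite size_cat size_map.
have f_lt y : y.2 < m1 -> f y = f1 y by rewrite /f => ->.
have f_up y : f (up y) = up (f2 y) by rewrite /f up_ge upK.
rewrite /parent_ok mem_cat; case: (ltnP x.2 m1) => xm.
  have /and5P[fs f2r fm adj ff] := ok1 x x1 xm.
  by rewrite !f_lt // fs f2r adj ff (leq_trans fm (leq_addr _ _)).
have xE : up (down x) = x.
  by case: x xm {x1 x2} => a b /= ab; rewrite /up /= subnKC.
move: x1 x2; rewrite -xE; move: (down x) => y /= y1; rewrite ltn_add2l => y2.
have /and5P[fs f2r fm adj ff] := ok2 y y1 y2.
rewrite !f_up map_f ?orbT // f2r ltn_add2l fm (can_eq upK) ff andbT /=.
by move: adj; rewrite /grid_adj /= -!addnS !eqn_add2l.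
Qed.

Definition table_parent (t : seq (seq (nat * nat))) (x : nat * nat) :=
  nth (0, 0) (nth [::] t x.1) x.2.

Lemma dominable_table m t (s := undup (flatten t)) :
    all (parent_ok m s (table_parent t))
      [seq (r, i) | r <- iota 0 2, i <- iota 0 m] ->
  dominable m (size s).
Proof.
move=> /allP ok; exists (table_parent t), s => // -[r i] /= r2 im; apply: ok.
by apply/allpairsP; exists (r, i); rewrite !mem_iota.
Qed.

(** In each table below the parents contain one directed 4-cycle, on two
    consecutive columns; all other vertices hang from it.  In [dominable4] the
    cycle occupies the two middle columns, and each of its vertices has a
    corner as a second child: this is the tight case, with no vertex wasted. *)
Lemma dominable3 : dominable 3 4.
Proof.
exact: (@dominable_table 3 [:: [:: (1, 0); (0, 0); (0, 1)];
                               [:: (1, 1); (0, 1); (1, 1)]]).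
Qed.

Lemma dominable4 : dominable 4 4.
Proof.
exact: (@dominable_table 4 [:: [:: (0, 1); (1, 1); (0, 1); (0, 2)];
                               [:: (1, 1); (1, 2); (0, 2); (1, 2)]]).
Qed.

Lemma dominable5 : dominable 5 6.
Proof.
exact: (@dominable_table 5 [:: [:: (0, 1); (1, 1); (0, 1); (0, 2); (0, 3)];
                               [:: (1, 1); (1, 2); (0, 2); (1, 2); (1, 3)]]).
Qed.

Lemma dominable6 : dominable 6 7.
Proof.
exact: (@dominable_table 6
  [:: [:: (0, 1); (1, 1); (0, 1); (0, 2); (0, 3); (0, 4)];
      [:: (1, 1); (1, 2); (0, 2); (1, 2); (0, 4); (1, 4)]]).
Qed.

Lemma dominable_mod4 m :
  3 <= m -> dominable m (if m %% 4 == 0 then m else m + 1).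
Proof.
elim/ltn_ind: m => m IHm m3; have [m7|m7] := leqP m 6.
  case: m m3 m7 {IHm} => [|[|[|[|[|[|[|m]]]]]]] // _ _;
    [exact: dominable3 | exact: dominable4
    |exact: dominable5 | exact: dominable6].
have [k mE] : exists k, m = 4 + k by exists (m - 4); lia.
rewrite mE modnDl -addnA.
have := dominable_cat dominable4 (IHm k _ _); case: ifP => _; apply; lia.
Qed.

Lemma dom_t_ladder_le m c : 0 < m -> dominable m c -> dom_t (ladder m) <= c.
Proof.
case: m => // n _ [f [s <- ok]].
pose emb (x : nat * nat) : ladder n.+1 := (inord x.1, inord x.2).
pose coord (x : ladder n.+1) : nat * nat := (val x.1, val x.2).
have coordK : cancel coord emb by case=> r i; rewrite /emb /= !inord_val.
have embK x : x.1 < 2 -> x.2 < n.+1 -> coord (emb x) = x.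
  by case: x => r i /= r2 im; rewrite /coord /= !inordK.
have ok_coord x : parent_ok n.+1 s f (coord x) by apply: ok; rewrite /= ltn_ord.
pose F x := emb (f (coord x)).
have FE x : coord (F x) = f (coord x).
  by have /and5P[_ f1 f2 _ _] := ok_coord x; rewrite embK.
apply: leq_trans (_ : #|[set x in map emb s]| <= _); last first.
  by rewrite cardsE -(size_map emb) card_size.
apply: (@dom_t_le _ F) => x; have /and5P[fs _ _ adj ff] := ok_coord x.
- move: adj; rewrite -FE /grid_adj => adj.
  rewrite /edge /= /cprod_edge /edge /= /path_edge /complete_edge.
  by rewrite -!val_eqE.
- by rewrite -(can_eq coordK) !FE.
- by rewrite inE /F map_f.
Qed.

Theorem theorem4p1 (m : nat) (hm : 3 <= m) :
  dom_t (cprod (complete_graph 2) (path_graph m)) =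
    if m == 0 %[mod 4] then m else m + 1.
Proof.
rewrite mod0n; apply/eqP; rewrite eqn_leq; apply/andP; split.
  by apply: dom_t_ladder_le (dominable_mod4 hm); apply: leq_trans hm.
case: m hm => // n n2.
apply: leq_dom_t => [|D S vD tdS].
  by rewrite card_prod !card_ord; case: ifP => _; lia.
have [+ _] := card_total_dominating (@degree_ladder_le3 n.+1) vD tdS.
rewrite card_prod !card_ord leq_pmul2l // => le_mS.
case: ifPn => // m4; rewrite addn1 ltn_neqAle le_mS andbT.
by apply: contraNneq m4 => /esym/(tight_mod4 vD tdS)->.
Qed.
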